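(* Let $r>0$, $V=\mathbb{R}$, and assume that $M(v)>0$ for all $v\in\mathbb{R}$. Then the equation $$\partial_tg+v\partial_xg=\big(M(v)\rho_g-g\big)+r\rho_g\big(M(v)-g\big)\quad\text{on }\mathbb{R}_+\times\mathbb{R}\times\mathbb{R}$$ does not admit any travelling wave solution.
   Context: $M\in L^1(\mathbb{R})\cap\mathcal{C}^0(\mathbb{R})$ satisfies $\int_{\mathbb{R}}M\,dv=1$, $\int_{\mathbb{R}}vM(v)\,dv=0$, $\int_{\mathbb{R}}v^2M(v)\,dv<+\infty$. $\rho_g(t,x)=\int_Vg(t,x,v)\,dv$. A travelling wave solution of speed $c\in\mathbb{R}_+$ is a solution of the form $g(t,x,v)=f(x-ct,v)$ with $f\in\mathcal{C}^2(\mathbb{R}\times V)$ satisfying, for all $(z,v)\in\mathbb{R}\times V$, $0\le f(z,v)\le M(v)$, $\lim_{z\to-\infty}f(z,v)=M(v)$, $\lim_{z\to+\infty}f(z,v)=0$; thus $(v-c)\partial_zf=(M(v)\rho_f-f)+r\rho_f(M(v)-f)$. *)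

(* Defs.v *)
From HB Require Import structures.
From mathcomp Require Import all_boot all_order all_algebra.
From mathcomp Require Import all_classical all_reals all_analysis.

Set Implicit Arguments.
Unset Strict Implicit.
Unset Printing Implicit Defensive.

Import Order.TTheory GRing.Theory Num.Theory.
Import numFieldNormedType.Exports.

Local Open Scope classical_set_scope.
Local Open Scope ring_scope.

(* Standing assumptions on M, for the velocity set V = R; all integrals are
   Lebesgue integrals. *)
Definition velocity_profile (R : realType) (M : R -> R) : Prop :=
  let mu := @lebesgue_measure R in
  [/\ continuous M,
      mu.-integrable setT (fun v => (M v)%:E),
      (\int[mu]_v (M v)%:E = 1)%E,
      (\int[mu]_v (v * M v)%:E = 0)%E &
      (\int[mu]_v (v ^+ 2 * M v)%:E < +oo)%E].

(* f is of class C^k on R x R: f is jointly continuous and, when k > 0, both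
   first-order partial derivatives exist everywhere and are of class C^(k-1). *)
Fixpoint class_C (R : realType) (k : nat) (f : R -> R -> R) : Prop :=
  continuous (fun p : R * R => f p.1 p.2) /\
  if k is k'.+1 then
    [/\ forall z v, derivable (fun y => f y v) z 1,
        forall z v, derivable (fun w => f z w) v 1,
        class_C k' (fun z v => derive1 (fun y => f y v) z) &
        class_C k' (fun z v => derive1 (fun w => f z w) v)]
  else True.

(* The integral is real-valued, with the value 0 if it is infinite; for a
   travelling wave 0 <= g <= M, so that it is finite. *)
Definition density (R : realType) (g : R -> R -> R -> R) (t x : R) : R :=
  \int[@lebesgue_measure R]_v g t x v.

(* l is the derivative of u at t relative to the half-line [0, +oo[: it is
   one-sided at t = 0 and the usual derivative at t > 0. *)
Definition is_time_derivative (R : realType) (u : R -> R) (t l : R) : Prop :=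
  (u s - u t) / (s - t) @[s --> within [set s : R | 0 <= s] t^'] --> l.

(* Only the values of g at times t >= 0 are relevant. *)
Definition kinetic_solution (R : realType) (r : R) (M : R -> R)
    (g : R -> R -> R -> R) : Prop :=
  forall t x v : R, 0 <= t ->
  exists dt dx : R,
    [/\ is_time_derivative (fun s => g s x v) t dt,
        is_derive x 1 (fun y => g t y v) dx &
        dt + v * dx =
          (M v * density g t x - g t x v)
          + r * density g t x * (M v - g t x v)].

Definition travelling_wave (R : realType) (r : R) (M : R -> R) (c : R)
    (g : R -> R -> R -> R) : Prop :=
  kinetic_solution r M g /\
  exists f : R -> R -> R,
    [/\ forall t x v, 0 <= t -> g t x v = f (x - c * t) v,
        class_C 2 f,
        forall z v, 0 <= f z v <= M v,
        forall v, f z v @[z --> -oo] --> M v &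
        forall v, f z v @[z --> +oo] --> (0 : R)].

(* Main.v *)
Require Import Defs.
From mathcomp Require Import all_boot all_order all_algebra.
From mathcomp Require Import all_classical all_reals all_analysis.
From mathcomp Require Import measurable_realfun.
From mathcomp Require Import ring lra.

Import Order.TTheory GRing.Theory Num.Theory.
Import numFieldNormedType.Exports.
Local Open Scope classical_set_scope.
Local Open Scope ring_scope.

Set Implicit Arguments.
Unset Strict Implicit.

(** In the frame of the wave, f solves
      (v - c) f_z = (1 + r) rho M - (1 + r rho) f,   rho = int f dv,
    and the contradiction lies in the behaviour of rho at z = +oo.

    On the one hand rho decays more slowly than any exponential.  For v > c the
    equation gives f_z >= - (1 + r) / (v - c) f, so the particles of velocity v
    ahead of the front decay at a rate of at most (1 + r) / (v - c), which is
    arbitrarily small for fast particles; since M > 0 everywhere, there are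
    always such particles ([wave_lower_bound], [density_slow_decay]).

    On the other hand rho is forced to decay exponentially, in an averaged
    sense.  The moments m_k = int (v - c)^k f dv satisfy ([is_derive_moment])
      m_1' = r rho (1 - rho),   m_2' = - (1 + r) c rho - (1 + r rho) m_1,
    and m_0 = rho, m_1, m_2 vanish at +oo by dominated convergence
    ([moment_cvg0]).  Far ahead of the front rho <= 1/2, so that j = - m_1 is
    nonincreasing, hence nonnegative, and controls rho through
    - j' >= (r / 2) rho.  With K = 2 (1 + r) c / r + 1, the quantity
    E = K j - m_2 then satisfies E' <= - j <= - E / K, the last step because
    m_2 >= 0.  Hence E = O(exp (- z / K)).  But integrating a lower bound
    rho >= C exp (- k z) twice, first to j and then to E, bounds E below by a
    multiple of exp (- k z), which is absurd for k < 1 / K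
    ([kpp_tail_contradiction]). *)

(** * Differential inequalities on a half-line *)

Lemma nonincreasing_of_derive (R : realType) (F dF : R -> R) (a : R) :
  (forall x, a <= x -> is_derive x 1 F (dF x)) ->
  (forall x, a <= x -> dF x <= 0) ->
  forall x y, a <= x -> x <= y -> F y <= F x.
Proof.
move=> F_dF dF_le0 x y ax xy.
have inside u : u \in `]x, y[ -> a <= u.
  by rewrite in_itv/= => /andP[/ltW xu _]; exact: le_trans xu.
apply: (@ler0_derive1_le_cc _ F x y) => //.
- by move=> u /inside au; have [] := F_dF u au.
- move=> u /inside au; rewrite derive1E.
  by have -> := @derive_val _ _ _ _ _ _ _ (F_dF u au); exact: dF_le0.
- apply: derivable_within_continuous => u; rewrite in_itv/= => /andP[xu _].
  by have [] := F_dF u (le_trans ax xu).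
- by rewrite bound_itvE.
- by rewrite bound_itvE.
Qed.

Lemma nonincreasing_cvg0_ge0 (R : realType) (F dF : R -> R) (a : R) :
  (forall x, a <= x -> is_derive x 1 F (dF x)) ->
  (forall x, a <= x -> dF x <= 0) ->
  F x @[x --> +oo] --> 0 ->
  forall x, a <= x -> 0 <= F x.
Proof.
move=> F_dF dF_le0 F0 x ax; apply: (cvgr_to_le F0).
near=> y.
apply: (nonincreasing_of_derive F_dF dF_le0 ax).
near: y; apply: nbhs_pinfty_ge; exact: num_real.
Unshelve. all: end_near. Qed.

(** Groenwall inequality: F(x) exp (k x) is nonincreasing. *)
Lemma gronwall_decay (R : realType) (F dF : R -> R) (k a : R) :
  (forall x, a <= x -> is_derive x 1 F (dF x)) ->
  (forall x, a <= x -> dF x <= - k * F x) ->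
  forall x, a <= x -> F x <= F a * expR (- k * (x - a)).
Proof.
move=> F_dF dF_le x ax.
pose G y := F y * expR (k * y).
have G_dG y : a <= y ->
    is_derive y 1 G ((dF y + k * F y) * expR (k * y)).
  move=> ay; have ? := F_dF y ay.
  by apply: is_derive_eq; rewrite !scaler1 /GRing.scale/=; ring.
have : G x <= G a.
  apply: (nonincreasing_of_derive G_dG) => // y ay.
  by rewrite mulr_le0_ge0 ?expR_ge0//; move: (dF_le y ay); lra.
rewrite /G mulNr mulrBr opprB expRD mulrA.
by rewrite expRN -ler_pdivlMr ?expR_gt0// .
Qed.

(** A function vanishing at infinity dominates the integral of any lower bound
    for minus its derivative; here that bound is C exp (- k x), whose tail
    integral is C / k exp (- k x). *)
Lemma exp_lower_bound (R : realType) (F dF : R -> R) (C k a : R) :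
  0 < k ->
  (forall x, a <= x -> is_derive x 1 F (dF x)) ->
  (forall x, a <= x -> dF x <= - C * expR (- k * x)) ->
  F x @[x --> +oo] --> 0 ->
  forall x, a <= x -> C / k * expR (- k * x) <= F x.
Proof.
move=> k0 F_dF dF_le F0 x ax.
pose G y := F y - C / k * expR (- k * y).
rewrite -subr_ge0 -/(G x).
apply: (@nonincreasing_cvg0_ge0 _ G
  (fun y => dF y + C * expR (- k * y)) a) => //.
- move=> y ay; have ? := F_dF y ay.
  apply: is_derive_eq; rewrite !scaler1 /GRing.scale/=.
  by field; rewrite gt_eqF.
- by move=> y ay; move: (dF_le y ay); lra.
- rewrite -[X in _ --> X](_ : 0 - C / k * 0 = 0); last by rewrite mulr0 subr0.
  apply: cvgB => //; apply: cvgMl_tmp.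
  under eq_fun do rewrite mulNr.
  apply: (@cvg_comp _ _ _ ( *%R k) (fun y => expR (- y))
    _ _ _ _ (@cvgr_expR R)).
  by apply: gt0_cvgMry.
Qed.

(** The part of the argument that only sees the moments: rho, m1 and m2 are the
    moments of order 0, 1 and 2 of the wave.  Since the second moment is
    nonnegative, the equations force exponential decay of a combination of m1
    and m2, at a rate that depends only on r and c, and this is incompatible
    with rho being larger than every exponential. *)
Lemma kpp_tail_contradiction (R : realType) (r c : R) (rho m1 m2 : R -> R) :
  0 < r -> 0 <= c ->
  (forall z, 0 <= rho z) -> (forall z, 0 <= m2 z) ->
  (forall z : R, is_derive z 1 m1 (r * rho z * (1 - rho z))) ->
  (forall z : R, is_derive z 1 m2
     (- ((1 + r) * c * rho z) - (1 + r * rho z) * m1 z)) ->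
  rho z @[z --> +oo] --> 0 ->
  m1 z @[z --> +oo] --> 0 ->
  m2 z @[z --> +oo] --> 0 ->
  (forall k : R, 0 < k ->
     exists2 C : R, 0 < C &
       forall z : R, 0 <= z -> C * expR (- k * z) <= rho z) ->
  False.
Proof.
move=> r0 c0 rho_ge0 m2_ge0 dm1 dm2 rho0 m10 m20 rho_slow.
have [a a0 rho_half] : exists2 a : R, 0 <= a &
    forall z : R, a <= z -> rho z <= 2^-1.
  have half0 : 0 < 2^-1 :> R by rewrite invr_gt0.
  move/cvgr_le : (rho0) => /(_ _ half0)[A [_ Ahalf]].
  exists (Num.max 0 (A + 1)); first by rewrite le_max lexx.
  by move=> z; rewrite ge_max => /andP[_ Az]; apply: Ahalf; lra.
(* 2 (1 + r) c / r makes K j' absorb the drift term (1 + r) c rho of m2'; the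
   summand 1 keeps K positive when c = 0. *)
pose K := 2 * (1 + r) * c / r + 1.
have Kr : K * r = 2 * (1 + r) * c + r by rewrite /K; field; rewrite gt_eqF.
have K0 : 0 < K by rewrite -(pmulr_lgt0 _ r0) Kr; nra.
pose E z := - K * m1 z - m2 z.
pose dE z := - K * (r * rho z * (1 - rho z))
  - (- ((1 + r) * c * rho z) - (1 + r * rho z) * m1 z).
have E_dE (z : R) : is_derive z 1 E (dE z).
  have ? := dm1 z; have ? := dm2 z; apply: is_derive_eq.
  by rewrite /GRing.scale/= /dE; ring.
pose j z := - m1 z.
pose dj z := - (r * rho z * (1 - rho z)).
have j_dj (z : R) : is_derive z 1 j (dj z).
  by have ? := dm1 z; apply: is_derive_eq.
have j0 : j z @[z --> +oo] --> 0 by rewrite -[X in _ --> X]oppr0; exact: cvgN.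
have E0 : E z @[z --> +oo] --> 0.
  rewrite -[X in _ --> X](_ : - K * 0 - 0 = 0); last by rewrite mulr0 subr0.
  by apply: cvgB => //; exact: cvgMl_tmp.
have dj_le z : a <= z -> dj z <= - (r / 2 * rho z).
  move=> /rho_half; rewrite -subr_ge0 => rz.
  by have := mulr_ge0 (mulr_ge0 (ltW r0) (rho_ge0 z)) rz; rewrite /dj; lra.
have j_ge0 z : a <= z -> 0 <= j z.
  move=> az; apply: (nonincreasing_cvg0_ge0 (dF := dj) (a := a)) => // x ax.
  apply: (le_trans (dj_le x ax)).
  by rewrite oppr_le0 mulr_ge0// divr_ge0// ltW.
have dE_le z : a <= z -> dE z <= - j z.
  move=> az; have jz := j_ge0 z az; have dz := dj_le z az.
  have rz := rho_ge0 z.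
  have KdJ : K * dj z <= - ((1 + r) * c * rho z).
    apply: (@le_trans _ _ (K * - (r / 2 * rho z))).
      by rewrite ler_pM2l.
    rewrite (_ : K * - (r / 2 * rho z) = - (K * r) / 2 * rho z); last by ring.
    by rewrite Kr; nra.
  have rrj : 0 <= r * rho z * j z by rewrite !mulr_ge0// ltW.
  by move: KdJ rrj; rewrite /dE /dj /j; lra.
(* The slow rate k is half the decay rate 1 / K of E. *)
have [k k0 kK] : exists2 k : R, 0 < k & 2 * k = K^-1.
  by exists (K^-1 / 2); [rewrite divr_gt0// invr_gt0|field; rewrite gt_eqF].
have E_upper z : a <= z -> E z <= E a * expR (- (2 * k) * (z - a)).
  move=> az; apply: (gronwall_decay (dF := dE)) => // x ax.
  apply: (le_trans (dE_le x ax)).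
  rewrite mulNr lerN2 kK ler_pdivrMl//.
  by have := m2_ge0 x; rewrite /E /j; lra.
have [C C0 rhoC] := rho_slow k k0.
have j_lower z : a <= z -> (r / 2 * C) / k * expR (- k * z) <= j z.
  move=> az; apply: (exp_lower_bound (dF := dj) (a := a)) => // x ax.
  apply: (le_trans (dj_le x ax)).
  rewrite mulNr lerN2 -(mulrA (r / 2)) ler_pM2l ?divr_gt0//.
  by apply: rhoC; exact: le_trans ax.
set C1 := r / 2 * C / k in j_lower.
have E_lower z : a <= z -> C1 / k * expR (- k * z) <= E z.
  move=> az; apply: (exp_lower_bound (dF := dE) (a := a)) => // x ax.
  by apply: (le_trans (dE_le x ax)); rewrite mulNr lerN2 j_lower.
set C2 := C1 / k in E_lower.
have C20 : 0 < C2.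
  by do ![exact: k0 | exact: C0 | exact: r0
         | apply: divr_gt0 | apply: mulr_gt0].
pose D := E a * expR (2 * k * a).
have exp_bounded z : a <= z -> C2 * expR (k * z) <= D.
  move=> az; have := le_trans (E_lower z az) (E_upper z az).
  rewrite (_ : - (2 * k) * (z - a) = 2 * k * a + - k * z + - k * z); last first.
    by ring.
  rewrite !expRD !mulrA -/D ler_pM2r ?expR_gt0//.
  by rewrite mulNr expRN ler_pdivlMr ?expR_gt0.
have D0 : 0 < D.
  by apply: lt_le_trans (exp_bounded a (lexx a)); rewrite mulr_gt0 ?expR_gt0.
(* From here expR (k z) >= 1 + k z > D / C2. *)
pose z := a + D / C2 / k.
have Dz : 0 <= D / C2 / k by apply: divr_ge0; [apply: divr_ge0|]; exact: ltW.
have := exp_bounded z; rewrite lerDl => /(_ Dz).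
rewrite leNgt => /negP; apply.
rewrite -ltr_pdivrMl// mulrC.
apply: (@lt_le_trans _ _ (1 + k * z)); last exact: expR_ge1Dx.
rewrite /z mulrDr mulrCA divff ?gt_eqF// mulr1.
by have := mulr_ge0 (ltW k0) a0; lra.
Qed.

(** * Integrability against the velocity profile *)

Lemma integrable_le_continuous (R : realType) (F G : R -> R) :
  continuous F ->
  (@lebesgue_measure R).-integrable setT (EFin \o G) ->
  (forall v, `|F v| <= G v) ->
  (@lebesgue_measure R).-integrable setT (EFin \o F).
Proof.
move=> cF intG FG; apply: (le_integrable measurableT _ _ intG).
  by apply/measurable_EFinP; exact: continuous_measurable_fun.
by move=> v _ /=; rewrite lee_fin (le_trans (FG v)) ?ler_norm.
Qed.

Lemma continuous_weight (R : realType) (F : R -> R) (c : R) (k : nat) :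
  continuous F -> continuous (fun v => (v - c) ^+ k * F v).
Proof.
move=> cF v; apply: cvgM; last exact: cF.
apply: (@continuous_comp _ _ _ (fun v => v - c) (fun x => x ^+ k)).
  by apply: cvgB; [exact: cvg_id|exact: cvg_cst].
exact: exprn_continuous.
Qed.

Lemma weight_le (R : realType) (v c : R) (k : nat) :
  (k <= 2)%N -> `|v - c| ^+ k <= (1 + 2 * c ^+ 2) + 2 * v ^+ 2.
Proof.
have sq : `|v - c| ^+ 2 <= 2 * c ^+ 2 + 2 * v ^+ 2.
  by rewrite -normrX ger0_norm ?sqr_ge0//; have := sqr_ge0 (v + c); nra.
have := sqr_ge0 c; have := sqr_ge0 v; have := normr_ge0 (v - c).
move=> x0 v0 c0; case: k => [|[|[|//]]] _; rewrite ?expr0 ?expr1.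
- by lra.
- by have := sqr_ge0 (`|v - c| - 1); nra.
- by lra.
Qed.

Lemma integrable_weight_profile (R : realType) (M : R -> R) (c : R) (k : nat) :
  velocity_profile M -> (forall v, 0 <= M v) -> (k <= 2)%N ->
  (@lebesgue_measure R).-integrable setT
    (EFin \o (fun v => `|v - c| ^+ k * M v)).
Proof.
move=> [cM intM _ _ M2] M0 k2.
have intM2 : (@lebesgue_measure R).-integrable setT
    (EFin \o (fun v => v ^+ 2 * M v)).
  apply/integrableP; split.
    apply/measurable_EFinP; apply: continuous_measurable_fun.
    by under eq_fun do rewrite -[X in X ^+ 2]subr0; exact: continuous_weight.
  under eq_integral => v _.
    rewrite /= ger0_norm; last by rewrite mulr_ge0 ?sqr_ge0.
    over.
  exact: M2.
have intG : (@lebesgue_measure R).-integrable setT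
    (EFin \o (fun v => (1 + 2 * c ^+ 2) * M v + 2 * (v ^+ 2 * M v))).
  rewrite (_ : EFin \o _ = (fun v => ((1 + 2 * c ^+ 2)%:E * (M v)%:E)%E) \+
    (fun v => (2%:E * (v ^+ 2 * M v)%:E)%E))%E//.
  by apply: integrableD => //; apply: integrableZl.
apply: (integrable_le_continuous _ intG) => [|v].
  under eq_fun do rewrite -normrX.
  move=> v; apply: cvgM; last exact: cM.
  apply: (@cvg_norm _ R^o).
  have := @continuous_weight R (fun=> 1) c k (@cst_continuous _ _ _) v.
  by under eq_fun do rewrite mulr1.
rewrite normrM ger0_norm ?exprn_ge0// ger0_norm// mulrA -mulrDl.
by rewrite ler_wpM2r// weight_le.
Qed.

(** * Moments of a steady wave *)

(** The profile of a travelling wave in the moving frame.  The equation is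
    stated for the derivative l at each point because it bounds (v - c) l by a
    multiple of M, which is the domination under which the moments are
    differentiated. *)
Definition steady_wave (R : realType) (r c : R) (M : R -> R)
    (f : R -> R -> R) : Prop :=
  let rho z := \int[@lebesgue_measure R]_v f z v in
  [/\ forall z, continuous (f z),
      forall z v, 0 <= f z v <= M v,
      forall v, f z v @[z --> +oo] --> (0 : R) &
      forall z v : R, exists2 l : R, is_derive z 1 (f ^~ v) l &
        (v - c) * l = (1 + r) * rho z * M v - (1 + r * rho z) * f z v].

Definition moment (R : realType) (c : R) (f : R -> R -> R) (k : nat) (z : R)
  : R := \int[@lebesgue_measure R]_v ((v - c) ^+ k * f z v).

Lemma moment0 (R : realType) (c : R) (f : R -> R -> R) (z : R) :
  moment c f 0 z = \int[@lebesgue_measure R]_v f z v.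
Proof. by apply: eq_Rintegral => v _; rewrite mul1r. Qed.

Section moments.
Context (R : realType) (r c : R) (M : R -> R) (f : R -> R -> R).
Hypotheses (r_gt0 : 0 < r) (M_profile : velocity_profile M)
  (f_wave : steady_wave r c M f).
Local Notation mu := (@lebesgue_measure R).
Local Notation rho := (moment c f 0).

Let M_ge0 v : 0 <= M v.
Proof.
by have [_ fM _ _] := f_wave; have /andP[] := fM 0 v; exact: le_trans.
Qed.

Lemma norm_weight_le k z v :
  `|(v - c) ^+ k * f z v| <= `|v - c| ^+ k * M v.
Proof.
have [_ fM _ _] := f_wave; have /andP[f0 fMv] := fM z v.
by rewrite normrM normrX (ger0_norm f0) ler_wpM2l ?exprn_ge0.
Qed.

Lemma integrable_weight_wave k z : (k <= 2)%N ->
  mu.-integrable setT (EFin \o (fun v => (v - c) ^+ k * f z v)).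
Proof.
move=> k2; have [cf _ _ _] := f_wave.
have intG := integrable_weight_profile c M_profile M_ge0 k2.
apply: (integrable_le_continuous _ intG).
  exact: continuous_weight.
by move=> v; exact: norm_weight_le.
Qed.

Lemma integrable_weight_M k : (k <= 2)%N ->
  mu.-integrable setT (EFin \o (fun v => (v - c) ^+ k * M v)).
Proof.
move=> k2; have [cM _ _ _ _] := M_profile.
have intG := integrable_weight_profile c M_profile M_ge0 k2.
apply: (integrable_le_continuous _ intG).
  exact: continuous_weight.
by move=> v; rewrite normrM normrX (ger0_norm (M_ge0 v)).
Qed.

(** Dominated convergence, with |v - c|^k M as the dominating function. *)
Lemma moment_cvg0 k : (k <= 2)%N -> moment c f k z @[z --> +oo] --> 0.
Proof.
move=> k2; have [cf _ f0 _] := f_wave.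
apply/cvg_pinftyP => u u_oo.
rewrite -[X in _ --> X](_ : fine (\int[mu]_v 0)%E = 0); last first.
  by rewrite integral0.
apply: fine_cvg; rewrite fineK ?integral0//.
rewrite -[X in _ --> X](integral0 mu setT).
apply: (@dominated_cvg _ _ _ mu _ _ (fun n v => ((v - c) ^+ k * f (u n) v)%:E) _
  (EFin \o (fun v => `|v - c| ^+ k * M v))) => //.
- move=> n; apply/measurable_EFinP; apply: continuous_measurable_fun.
  exact: continuous_weight.
- move=> v _; apply: cvg_EFin; first exact: nearW.
  have /cvg_pinftyP/(_ _ u_oo) fu := f0 v.
  rewrite -[X in _ --> X](mulr0 ((v - c) ^+ k)).
  exact: cvgMl_tmp.
- exact: (integrable_weight_profile c M_profile M_ge0 k2).
- by move=> n v _; rewrite lee_fin norm_weight_le.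
Qed.

Lemma moment_profile0 : \int[mu]_v ((v - c) ^+ 0 * M v) = 1.
Proof.
have [_ _ M1 _ _] := M_profile.
by under eq_Rintegral do rewrite mul1r; rewrite /Rintegral M1.
Qed.

Lemma moment_profile1 : \int[mu]_v ((v - c) ^+ 1 * M v) = - c.
Proof.
have [cM intM M1 vM _] := M_profile.
have -> : \int[mu]_v ((v - c) ^+ 1 * M v) =
    \int[mu]_v (v * M v - c * M v).
  by apply: eq_Rintegral => v _; rewrite expr1 mulrBl.
have intvM : mu.-integrable setT (EFin \o (fun v => v * M v)).
  have intG := integrable_weight_profile 0 M_profile M_ge0 (isT : (1 <= 2)%N).
  apply: (integrable_le_continuous _ intG).
    by move=> v; apply: cvgM => //; exact: cM.
  by move=> v; rewrite normrM subr0 expr1 (ger0_norm (M_ge0 v)).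
have intcM : mu.-integrable setT (EFin \o (fun v => c * M v)).
  rewrite (_ : EFin \o _ = (fun v => (c%:E * (M v)%:E)%E))//.
  exact: integrableZl.
rewrite RintegralB// RintegralZl//.
by rewrite /Rintegral vM M1 /= mulr1 sub0r.
Qed.

Lemma density_bounds z : 0 <= rho z <= 1.
Proof.
have [_ fM _ _] := f_wave; apply/andP; split.
  by apply: Rintegral_ge0 => v _; rewrite mul1r; case/andP: (fM z v).
rewrite -moment_profile0; apply: le_Rintegral => //.
- exact: integrable_weight_wave.
- exact: integrable_weight_M.
- by move=> v _; rewrite !mul1r; case/andP: (fM z v).
Qed.

(** One factor v - c of the weight turns f_z into the right-hand side of the
    kinetic equation, whose integral only involves moments of M and of f of
    order k. *)
Lemma is_derive_moment k (z : R) : (k < 2)%N ->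
  is_derive z 1 (moment c f k.+1)
    ((1 + r) * rho z * \int[mu]_v ((v - c) ^+ k * M v)
     - (1 + r * rho z) * moment c f k z).
Proof.
move=> k2; have k2' := ltnW k2; have [cf fM _ feq] := f_wave.
pose F y v := (v - c) ^+ k.+1 * f y v.
pose dF y v := (v - c) ^+ k *
  ((1 + r) * rho y * M v - (1 + r * rho y) * f y v).
have F_dF (y : R) v : is_derive y 1 (F ^~ v) (dF y v).
  have [l dl le] := feq y v.
  apply: is_derive_eq; rewrite /dF moment0 -le.
  by rewrite /GRing.scale/= exprSr; ring.
have d1F y v : partial1of2 F y v = dF y v.
  by rewrite partial1of2E; exact: derive_val.
pose G v := 2 * (1 + r) * (`|v - c| ^+ k * M v).
have intG : mu.-integrable setT (EFin \o G).
  rewrite (_ : EFin \o G =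
    (fun v => ((2 * (1 + r))%:E * (`|v - c| ^+ k * M v)%:E)%E))//.
  apply: integrableZl => //.
  exact: (integrable_weight_profile c M_profile M_ge0 k2').
have G_ge0 v : 0 <= G v.
  rewrite /G; apply: mulr_ge0; last by rewrite mulr_ge0 ?exprn_ge0.
  by have := r_gt0; lra.
have d1F_G y v : `|partial1of2 F y v| <= G v.
  rewrite d1F /dF /G normrM normrX mulrCA ler_wpM2l ?exprn_ge0//.
  (* Both terms of the right-hand side lie between 0 and (1 + r) M. *)
  have /andP[r0 r1] := density_bounds y; have /andP[f0 fMv] := fM y v.
  have rr1 : r * rho y <= r by rewrite -[leRHS]mulr1 ler_pM2l.
  have rr0 : 0 <= r * rho y by rewrite mulr_ge0// ltW.
  have A : 0 <= (1 + r) * rho y * M v <= (1 + r) * M v.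
    by rewrite mulr_ge0 ?mulr_ge0//= ?ler_wpM2r//; lra.
  have B : 0 <= (1 + r * rho y) * f y v <= (1 + r) * M v.
    by rewrite mulr_ge0//= ?ler_pM//; lra.
  by rewrite ler_norml; lra.
(* The domination is uniform in z, so any interval around z does. *)
have zI : `]z - 1, z + 1[%classic z by rewrite /= in_itv/=; lra.
have intF y : `]z - 1, z + 1[%classic y -> mu.-integrable setT (EFin \o F y).
  by move=> _; exact: integrable_weight_wave.
have derF y v : `]z - 1, z + 1[%classic y -> setT v -> derivable (F ^~ v) y 1.
  by move=> _ _; have [] := F_dF y v.
have G_ub y v : `]z - 1, z + 1[%classic y -> setT v ->
    `|partial1of2 F y v| <= G v by [].
have dM := derivable_under_integral measurableT zI intF derF G_ge0 intG G_ub.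
apply: DeriveDef; first exact: dM.
rewrite -derive1E.
rewrite (differentiation_under_integral
  measurableT zI intF derF G_ge0 intG G_ub).
transitivity (\int[mu]_v ((1 + r) * rho z * ((v - c) ^+ k * M v)
    - (1 + r * rho z) * ((v - c) ^+ k * f z v))).
  by apply: eq_Rintegral => v _; rewrite d1F /dF; ring.
have intwM := integrable_weight_M k2'.
have intwf := integrable_weight_wave z k2'.
rewrite RintegralB//.
- by rewrite !RintegralZl.
- by apply: (integrableZl measurableT _ intwM).
- by apply: (integrableZl measurableT _ intwf).
Qed.

End moments.

(** * Slow decay ahead of the front *)

(** Since rho M >= 0 and rho <= 1, the worst case of the equation for v > c is
    pure absorption, (v - c) f_z = - (1 + r) f. *)
Lemma wave_lower_bound (R : realType) (r c : R) (M : R -> R) (f : R -> R -> R)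
    (v x y : R) :
  0 < r -> velocity_profile M -> steady_wave r c M f -> c < v -> x <= y ->
  f x v * expR (- ((1 + r) / (v - c)) * (y - x)) <= f y v.
Proof.
move=> r0 M_profile f_wave cv xy.
have [_ fM _ feq] := f_wave.
have vc : 0 < v - c by rewrite subr_gt0.
pose F z := - f z v.
pose dF z := - sval (cid2 (feq z v)).
have F_dF z : x <= z -> is_derive z 1 F (dF z).
  rewrite /dF; case: cid2 => l dl _ _ /=.
  exact: is_derive_eq.
have dF_le z : x <= z -> dF z <= - ((1 + r) / (v - c)) * F z.
  rewrite /dF /F; case: cid2 => l _ le _ /=.
  rewrite mulrNN mulrAC ler_pdivlMr// mulNr mulrC le.
  have /andP[rho0 rho1] := density_bounds M_profile f_wave z.
  rewrite moment0 in rho0 rho1.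
  have /andP[f0 fMv] := fM z v.
  have M0 : 0 <= M v by exact: le_trans fMv.
  rewrite opprB.
  set q := (\int[lebesgue_measure]_w f z w) in rho0 rho1 *.
  have A : 0 <= (1 + r) * q * M v by rewrite !mulr_ge0//; lra.
  have B : r * q * f z v <= r * f z v.
    by rewrite ler_wpM2r// -[leRHS]mulr1 ler_pM2l.
  by move: A B; lra.
have := gronwall_decay F_dF dF_le xy.
by rewrite /F mulNr lerN2.
Qed.

(** Velocities beyond c + (1 + r) / k decay at a rate of at most k, and those in
    a unit interval there already carry a positive mass at z = 0. *)
Lemma density_slow_decay (R : realType) (r c : R) (M : R -> R)
    (f : R -> R -> R) :
  0 < r -> velocity_profile M -> steady_wave r c M f ->
  (forall v, 0 < M v) -> (forall v, f z v @[z --> -oo] --> M v) ->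
  forall k : R, 0 < k ->
  exists2 C : R, 0 < C &
    forall z : R, 0 <= z -> C * expR (- k * z) <= moment c f 0 z.
Proof.
move=> r0 M_profile f_wave M0 fM k k0.
have [cf fM' _ _] := f_wave.
(* f(., v) is positive near -oo, where it tends to M v, and stays so. *)
have f0_gt0 v : c < v -> 0 < f 0 v.
  move=> cv; have /cvgr_gt/(_ _ (M0 v))[A [_ Af]] := fM v.
  pose x := Num.min (A - 1) 0.
  have xA : x < A by rewrite gt_min; apply/orP; left; lra.
  have x0 : x <= 0 by rewrite ge_min lexx orbT.
  apply: lt_le_trans (wave_lower_bound r0 M_profile f_wave cv x0).
  by rewrite mulr_gt0 ?expR_gt0//; exact: Af.
pose a := c + (1 + r) / k.
have rk0 : 0 < (1 + r) / k by rewrite divr_gt0//; lra.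
have [v0 v0I f_min] : exists2 v0 : R, v0 \in `[a, a + 1]%R &
    forall v, v \in `[a, a + 1]%R -> f 0 v0 <= f 0 v.
  apply: EVT_min; first by lra.
  by apply: continuous_subspaceT => v; exact: cf.
have above_c v : v \in `[a, a + 1]%R -> (1 + r) / k <= v - c.
  by rewrite in_itv/= /a => /andP[+ _]; lra.
have v0c : c < v0 by have := above_c _ v0I; lra.
exists (f 0 v0) => [|z z0]; first exact: f0_gt0.
set e := f 0 v0 * expR (- k * z).
have e0 : 0 <= e by rewrite mulr_ge0 ?expR_ge0// ltW// f0_gt0.
have e_le v : v \in `[a, a + 1]%R -> e <= f z v.
  move=> vI; have kv := above_c v vI.
  have cv : c < v by lra.
  apply: le_trans (wave_lower_bound r0 M_profile f_wave cv z0).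
  rewrite subr0 ler_pM ?expR_ge0//.
  - by rewrite ltW// f0_gt0.
  - exact: f_min.
  - rewrite ler_expR ler_wpM2r// lerN2 ler_pdivrMr ?subr_gt0// mulrC.
    by rewrite -ler_pdivrMr.
have -> : e = \int[@lebesgue_measure R]_(v in `[a, a + 1]) e.
  rewrite Rintegral_cst//.
  rewrite /= lebesgue_measure_itv/= lte_fin ltrDl ltr01.
  by rewrite -EFinD/= addrAC subrr add0r mulr1.
rewrite Rintegral_mkcond; apply: le_Rintegral => //.
- rewrite (_ : EFin \o _ = (EFin \o (fun=> e)) \_ `[a, a + 1]).
    rewrite -integrable_mkcond//.
    apply: continuous_compact_integrable; first exact: segment_compact.
    by move=> ?; exact: cvg_cst.
  by rewrite restrict_EFin.
- exact: (integrable_weight_wave M_profile f_wave).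
- move=> v _; rewrite mul1r patchE; case: ifPn => [|_].
    by rewrite inE => /e_le.
  by have /andP[] := fM' z v.
Qed.

(** * From travelling waves to steady waves *)

Lemma cvg_within_ge0_at_right (R : realType) (F : R -> R) (l : R) :
  F s @[s --> within [set s : R | 0 <= s] 0^'] --> l ->
  F s @[s --> 0^'+] --> l.
Proof.
move=> Fl P /Fl FP.
have {}FP : \forall s \near (0 : R), s != 0 -> 0 <= s -> P (F s) := FP.
have : \forall s \near (0 : R), 0 < s -> P (F s).
  by apply: filterS FP => s Ps s0; apply: Ps; [rewrite gt_eqF|exact: ltW].
by [].
Qed.

(** Evaluating the equation at t = 0 is enough: there the one-sided time
    derivative of g is - c f_z by the chain rule. *)
Lemma travelling_wave_steady (R : realType) (r c : R) (M : R -> R)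
    (g : R -> R -> R -> R) :
  travelling_wave r M c g ->
  exists2 f : R -> R -> R, steady_wave r c M f &
    forall v, f z v @[z --> -oo] --> M v.
Proof.
move=> [g_sol [f [gf Cf fM fNy fy]]]; exists f => //.
have [cf _] := Cf.
have g0 z v : g 0 z v = f z v by rewrite gf// mulr0 subr0.
split=> // [z v|z v].
  exact: (continuous2_cvg _ (cf (z, v)) (cvg_cst z) cvg_id).
have [dt [dx [g_dt g_dx g_eq]]] := g_sol 0 z v (lexx 0).
have f_dx : is_derive z 1 (f ^~ v) dx.
  by move: g_dx; rewrite (_ : (fun y => g 0 y v) = f ^~ v)//; apply/funext.
exists dx => //.
have dtE : dt = - c * dx.
  pose U s := f (z - c * s) v.
  have U_ds : is_derive (0 : R) 1 U (- c * dx).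
    rewrite mulrC.
    have h_ds : is_derive (0 : R) 1 (fun s : R => z - c * s) (- c).
      by apply: is_derive_eq; rewrite /GRing.scale/=; ring.
    have f_dx' : is_derive ((fun s : R => z - c * s) 0) 1 (f ^~ v) dx.
      by rewrite mulr0 subr0.
    exact: (@is_derive1_comp _ (f ^~ v) (fun s => z - c * s)
      0 dx (- c) f_dx' h_ds).
  have U_lim : (U s - U 0) / s @[s --> 0^'+] --> - c * dx.
    have [U_der <-] := U_ds.
    apply: cvg_dnbhs_at_right; rewrite /derive.
    move: U_der; rewrite /derivable.
    have -> : (fun h : R => h^-1 *: ((U \o shift 0) (h *: 1) - U 0)) =
        (fun s => (U s - U 0) / s).
      by apply/funext => h; rewrite /= scaler1 addr0 mulrC.
    exact.
  have g_lim : (U s - U 0) / s @[s --> 0^'+] --> dt.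
    have gU : {near 0^'+, (fun s => (g s z v - g 0 z v) / (s - 0)) =1
                          (fun s => (U s - U 0) / s)}.
      near=> s.
      have s0 : 0 <= s by apply: ltW; near: s; exact: nbhs_right_gt.
      by rewrite subr0 !gf.
    exact: cvg_trans (near_eq_cvg gU) (cvg_within_ge0_at_right g_dt).
  exact: (cvg_unique _ g_lim U_lim).
have -> : \int[@lebesgue_measure R]_v f z v = density g 0 z.
  by apply: eq_Rintegral => w _; rewrite g0.
by move: g_eq; rewrite dtE g0; lra.
Unshelve. all: end_near. Qed.

(** * Nonexistence of travelling waves *)

Theorem corollary1p10 (R : realType) (r : R) (M : R -> R) (r_gt0 : 0 < r)
    (M_profile : velocity_profile M) (M_gt0 : forall v : R, 0 < M v) :
  ~ exists (c : R) (g : R -> R -> R -> R), 0 <= c /\ travelling_wave r M c g.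
Proof.
move=> [c [g [c0 /travelling_wave_steady[f f_wave f_Ny]]]].
have [_ fM _ _] := f_wave.
apply: (kpp_tail_contradiction r_gt0 c0
  (rho := moment c f 0) (m1 := moment c f 1) (m2 := moment c f 2)).
- by move=> z; have /andP[] := density_bounds M_profile f_wave z.
- move=> z; apply: Rintegral_ge0 => v _; rewrite mulr_ge0 ?sqr_ge0//.
  by have /andP[] := fM z v.
- move=> z.
  apply: (is_derive_eq (is_derive_moment r_gt0 M_profile f_wave z _)) => //.
  by rewrite (moment_profile0 c M_profile); ring.
- move=> z.
  apply: (is_derive_eq (is_derive_moment r_gt0 M_profile f_wave z _)) => //.
  by rewrite (moment_profile1 M_profile f_wave); ring.
- exact: (moment_cvg0 M_profile f_wave).
- exact: (moment_cvg0 M_profile f_wave).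
- exact: (moment_cvg0 M_profile f_wave).
- exact: (density_slow_decay r_gt0 M_profile f_wave).
Qed.
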